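(* If $N$ is a power of a prime, then $N^{3/4}\le B(N)$.
   Context: An orthogonal array $OA(N, s_1^{k_1} s_2^{k_2}\cdots s_v^{k_v})$ (of strength 2) is an $N\times k$ array, $k=k_1+\cdots+k_v$, whose first $k_1$ columns have entries from $\{0,\dots,s_1-1\}$, next $k_2$ columns entries from $\{0,\dots,s_2-1\}$, etc., such that in every $N\times 2$ subarray every possible ordered pair of symbols occurs equally often as a row; here $2\le s_1<s_2<\cdots$ and $k_i\ge 1$. A (putative) parameter set is a symbol $(N,s_1^{k_1}s_2^{k_2}\cdots)$ satisfying: (C1) each $s_i$ divides $N$; (C2) $s_i^2$ divides $N$ whenever $k_i\ge 2$; (C3) $s_is_j$ divides $N$ for $i\ne j$; (C4) $N-1\ge k_1(s_1-1)+k_2(s_2-1)+\cdots$. Its number of degrees of freedom is $k_1(s_1-1)+k_2(s_2-1)+\cdots$. It is realized if an $OA(N,s_1^{k_1}s_2^{k_2}\cdots)$ exists. The threshold function $B(N)$ is the maximum integer $b$ such that every parameter set with $N$ runs having at most $b$ degrees of freedom is realized, while some parameter set with $b+1$ degrees of freedom is not realized; if every parameter set with $N$ runs is realized, $B(N)=N-1$.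
   Formalization: The formal statement assumes N > 3, because the claim fails at the prime powers N = 2 and N = 3, where B(2) = 1 < 2^{3/4} and B(3) = 2 < 3^{3/4}; all other prime powers p^e with e ≥ 1 are covered. *)

(* Defs.v *)
From HB Require Import structures.
From mathcomp Require Import all_boot all_order all_algebra.
From mathcomp Require Import boolp.

Set Implicit Arguments.
Unset Strict Implicit.
Unset Printing Implicit Defensive.

(* [:: (s_1, k_1); ...; (s_v, k_v)] stands for the symbol s_1^k_1 ... s_v^k_v.
   The empty symbol is allowed; it has 0 degrees of freedom and is always
   realized, so it does not affect the threshold. *)
Definition symbol := seq (nat * nat).

Definition deg_freedom (ps : symbol) : nat := \sum_(x <- ps) x.2 * (x.1 - 1).

Definition wf_symbol (ps : symbol) : Prop :=
  sorted ltn (unzip1 ps) /\ (forall x, x \in ps -> 2 <= x.1 /\ 1 <= x.2).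

(* The s_i are pairwise distinct in a well-formed symbol, so in the third
   divisibility condition [x != y] says that the indices differ. *)
Definition parameter_set (N : nat) (ps : symbol) : Prop :=
  [/\ wf_symbol ps,
      (forall x, x \in ps -> x.1 %| N),
      (forall x, x \in ps -> 2 <= x.2 -> x.1 ^ 2 %| N),
      (forall x y, x \in ps -> y \in ps -> x != y -> x.1 * y.1 %| N)
    & deg_freedom ps <= N - 1].

(* Number of levels of each column: s_1 repeated k_1 times, then s_2, etc. *)
Definition col_levels (ps : symbol) : seq nat :=
  flatten [seq nseq x.2 x.1 | x <- ps].

Definition pair_count (N k : nat) (A : 'M[nat]_(N, k)) (j1 j2 : 'I_k)
    (a b : nat) : nat :=
  #|[set i : 'I_N | (A i j1 == a) && (A i j2 == b)]|.

Definition orthogonal_array (N : nat) (lv : seq nat)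
    (A : 'M[nat]_(N, size lv)) : Prop :=
  (forall i j, A i j < nth 0 lv j) /\
  (forall j1 j2 : 'I_(size lv), j1 != j2 ->
   forall a b a' b' : nat,
     a < nth 0 lv j1 -> b < nth 0 lv j2 ->
     a' < nth 0 lv j1 -> b' < nth 0 lv j2 ->
     pair_count A j1 j2 a b = pair_count A j1 j2 a' b').

Definition realized (N : nat) (ps : symbol) : Prop :=
  exists A : 'M[nat]_(N, size (col_levels ps)), orthogonal_array A.

Definition all_realized (N : nat) : Prop :=
  forall ps, parameter_set N ps -> realized N ps.

Definition threshold_at (N b : nat) : Prop :=
  (forall ps, parameter_set N ps -> deg_freedom ps <= b -> realized N ps) /\
  (exists ps, [/\ parameter_set N ps, deg_freedom ps = b.+1
                & ~ realized N ps]).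

(* The bound b < N loses nothing: see [threshold_at_lt]. *)
Definition threshold (N : nat) : nat :=
  if `[< all_realized N >] then N - 1
  else \max_(b < N | `[< threshold_at N b >]) b.

Lemma threshold_at_lt (N b : nat) : threshold_at N b -> b < N.
Proof.
case=> _ [ps [[_ _ _ _ h] e _]]; move: h; rewrite e => h.
exact: leq_trans h (leq_subr 1 N).
Qed.

Lemma threshold_at_uniq (N b c : nat) :
  threshold_at N b -> threshold_at N c -> b = c.
Proof.
move=> [hb [ps [pb eb nb]]] [hc [qs [pc ec nc]]].
case: (ltngtP b c) => // h.
- by case: nb; apply: hc; rewrite ?eb.
- by case: nc; apply: hb; rewrite ?ec.
Qed.

Lemma realized_nil (N : nat) : realized N [::].
Proof. by exists (const_mx 0); split=> [i []|[]]. Qed.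

Lemma deg_freedom_gt0 (ps : symbol) :
  wf_symbol ps -> ps <> [::] -> 0 < deg_freedom ps.
Proof.
case: ps => // -[s k] ps [_ h] _; rewrite /deg_freedom big_cons /=.
have [hs hk] := h (s, k) (mem_head _ _).
by rewrite addn_gt0 muln_gt0 subn_gt0 hs hk.
Qed.

Lemma thresholdP (N : nat) : ~ all_realized N -> threshold_at N (threshold N).
Proof.
move=> nall.
pose P d := `[< exists ps,
  [/\ parameter_set N ps, deg_freedom ps = d & ~ realized N ps] >].
have exP : exists d, P d.
  apply: contrapT => nP; apply: nall => ps hps; apply: contrapT => nr.
  by apply: nP; exists (deg_freedom ps); apply/asboolP; exists ps.
have [[|b] /asboolP[ps [hps e nr]] bmin] := ex_minnP exP.
  have wf : wf_symbol ps by case: hps.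
  have /(deg_freedom_gt0 wf) : ps <> [::].
    by move=> ps0; apply: nr; rewrite ps0; exact: realized_nil.
  by rewrite e.
have hb : threshold_at N b.
  split; last by exists ps.
  move=> qs hqs le_qs; apply: contrapT => nqs.
  have /bmin : P (deg_freedom qs) by apply/asboolP; exists qs.
  by rewrite leqNgt ltnS le_qs.
suff -> : threshold N = b by [].
rewrite /threshold asboolF //.
apply/eqP; rewrite eqn_leq; apply/andP; split.
  by apply/bigmax_leqP => c /asboolP hc; rewrite (threshold_at_uniq hc hb).
exact: (@leq_bigmax_cond _ _ _ (Ordinal (threshold_at_lt hb)) (asboolT hb)).
Qed.

(* Main.v *)
Require Import Defs.
From HB Require Import structures.
From mathcomp Require Import all_boot all_order all_algebra.
From mathcomp Require Import reals exp.
From mathcomp Require Import all_field mxabelem zify boolp.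

(** If pairwise trivially intersecting subspaces of dimensions [a_1, ..., a_k]
    of the space of row vectors over ['F_p] of length [e] exist, then the dual
    linear maps are the columns of an orthogonal array with [p ^ e] runs and
    [p ^ a_j] levels.  Let [d] be the number of degrees of freedom, with
    [(d - 1) ^ 4 < p ^ (3 * e)].  Subspaces of dimension [a] with
    [4 * (a - 1) <= e] can be added greedily, spanning vector by vector: at most
    [p ^ (a - 1) * (d' + 1) < p ^ e] vectors have to be avoided, where [d'] is
    the number of nonzero vectors covered so far.  The remaining, larger
    subspaces number at most [p ^ A] whenever [e <= 2 * A], so they fit in
    distinct members of a partial spread made of one subspace of dimension [A]
    and [p ^ A] subspaces of dimension [e - A], where [A] is the larger of
    [e / 2] (rounded up) and the biggest dimension. *)

Import GRing.Theory Num.Theory VectorInternalTheory.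

Local Open Scope ring_scope.

(** * Subspaces that meet trivially *)

Definition mxdisjoint {F : fieldType} {n : nat} (A B : 'M[F]_n) : bool :=
  (A :&: B)%MS == 0.

Lemma mxdisjointP {F : fieldType} {n : nat} (A B : 'M[F]_n) :
  reflect (forall v : 'rV_n, (v <= A)%MS -> (v <= B)%MS -> v = 0)
          (mxdisjoint A B).
Proof.
apply: (iffP (@rowV0P _ _ _ _)) => h v.
  by move=> vA vB; apply: h; rewrite sub_capmx vA.
by rewrite sub_capmx => /andP[]; apply: h.
Qed.

Lemma mxdisjoint_sym {F : fieldType} {n : nat} (A B : 'M[F]_n) :
  mxdisjoint A B = mxdisjoint B A.
Proof. by rewrite /mxdisjoint capmxC. Qed.

Lemma mxdisjointS {F : fieldType} {n : nat} (A A' B B' : 'M[F]_n) :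
  (A' <= A)%MS -> (B' <= B)%MS -> mxdisjoint A B -> mxdisjoint A' B'.
Proof.
move=> sA sB /mxdisjointP h; apply/mxdisjointP => v vA vB.
exact: h (submx_trans vA sA) (submx_trans vB sB).
Qed.

Lemma exists_submx_rank {F : fieldType} {m n : nat} (G : 'M[F]_(m, n))
    (a : nat) :
  (a <= \rank G)%N -> exists2 H : 'M[F]_n, (H <= G)%MS & \rank H = a.
Proof.
move=> le_a; exists <<(pid_mx a : 'M_(a, _)) *m row_base G>>%MS.
  by rewrite genmxE (submx_trans (submxMl _ _)) ?eq_row_base.
by rewrite genmxE mxrankMfree ?row_base_free // rank_pid_mx.
Qed.

Lemma exists_disjoint_submx {F : fieldType} {n : nat} (s : seq 'M[F]_n)
    (al : seq nat) :
    pairwise mxdisjoint s -> (size al <= size s)%N ->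
    (forall i, (i < size al)%N -> (nth 0%N al i <= \rank (nth 0%R s i))%N) ->
  exists2 fam : seq 'M[F]_n, pairwise mxdisjoint fam
    & [seq \rank G | G <- fam] = al.
Proof.
move=> pw le_s le_rank.
have /choice[H HP] i : exists H : 'M[F]_n, (i < size al)%N ->
    (H <= nth 0 s i)%MS /\ \rank H = nth 0%N al i.
  have [lti|_] := boolP (i < size al)%N; last by exists 0.
  by have [H sH rH] := exists_submx_rank _ _ (le_rank i lti); exists H.
exists (mkseq H (size al)).
  apply/(pairwiseP 0) => i j; rewrite !inE size_mkseq => lti ltj ltij.
  rewrite !nth_mkseq //; have [sHi _] := HP i lti; have [sHj _] := HP j ltj.
  apply: mxdisjointS sHi sHj _; move/(pairwiseP 0): pw; apply => //.
    exact: leq_trans lti le_s.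
  exact: leq_trans ltj le_s.
apply: (@eq_from_nth _ 0%N); first by rewrite size_map size_mkseq.
move=> i; rewrite size_map size_mkseq => lti.
by rewrite (nth_map 0) ?size_mkseq // nth_mkseq //; exact: proj2 (HP i lti).
Qed.

(** * Greedy construction of a subspace *)

(** All the subspaces to avoid contain [W]. Outside [W], each [W + G] has only |W| (|G| - 1)
    vectors, so the union is too small to be the whole space. *)
Lemma exists_row_avoiding {F : finFieldType} {n : nat} (W : 'M[F]_n)
    (fam : seq 'M[F]_n) :
    all (mxdisjoint W) fam ->
    (#|F| ^ \rank W * (1 + \sum_(G <- fam) (#|F| ^ \rank G - 1))
      < #|F| ^ n)%N ->
  exists2 v : 'rV[F]_n, ~~ (v <= W)%MS
    & all (fun G => ~~ (v <= W + G)%MS) fam.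
Proof.
move=> disj lt_n.
pose X s := foldr (fun (G : 'M[F]_n) Y => rowg (W + G)%MS :|: Y) (rowg W) s.
have sWX s : rowg W \subset X s.
  by elim: s => //= G s IH; rewrite (subset_trans IH) ?subsetUr.
have cardX s : all (mxdisjoint W) s ->
    (#|X s| <= #|F| ^ \rank W * (1 + \sum_(G <- s) (#|F| ^ \rank G - 1)))%N.
  elim: s => [|G s IH] /=; first by rewrite big_nil addn0 muln1 card_rowg.
  case/andP=> WG /IH {}IH; rewrite big_cons addnCA mulnDr.
  (* [X s] already contains [W], so only the part of [W + G] outside [W] has to be counted. *)
  have -> : rowg (W + G)%MS :|: X s = (rowg (W + G)%MS :\: rowg W) :|: X s.
    apply/setP=> v; rewrite in_setU [in RHS]in_setU in_setD.
    by case vW: (v \in rowg W) => //=; rewrite (subsetP (sWX s) _ vW) orbT.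
  apply: leq_trans (leq_card_setU _ _) _; apply: leq_add IH.
  have sW : rowg W \subset rowg (W + G)%MS.
    apply/subsetP=> v; rewrite !mem_rowg => /submx_trans; apply.
    exact: addsmxSl.
  rewrite cardsD (setIidPr sW) !card_rowg mxrank_disjoint_sum; last exact/eqP.
  by rewrite expnD mulnBr muln1.
have /subsetPn[v _ vX] : ~~ ([set: 'rV[F]_n] \subset X fam).
  apply: contraL lt_n => /subset_leq_card.
  by rewrite cardsT card_mx mul1n -leqNgt => /leq_trans; apply; apply: cardX.
exists v; first by apply: contra vX; rewrite -mem_rowg; apply/subsetP/sWX.
elim: fam vX {disj lt_n} => //= G s IH; rewrite in_setU negb_or mem_rowg.
by case/andP=> -> /IH.
Qed.

(** [W] grows by one vector at a time. The last vector is added to a subspace of dimension [a.-1],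
    which is the tightest case of the counting bound. *)
Lemma exists_disjoint_mx {F : finFieldType} {n : nat} (fam : seq 'M[F]_n)
    (a : nat) :
    (#|F| ^ a.-1 * (1 + \sum_(G <- fam) (#|F| ^ \rank G - 1)) < #|F| ^ n)%N ->
  exists2 W : 'M[F]_n, \rank W = a & all (mxdisjoint W) fam.
Proof.
elim: a => [|a IH] lt_n.
  exists 0; first exact: mxrank0.
  by apply/allP=> G _; apply/mxdisjointP=> v; rewrite submx0 => /eqP.
case: IH => [|W rW disj].
  apply: leq_ltn_trans lt_n; rewrite leq_mul2r leq_exp2l ?leq_pred ?orbT //.
  exact: finRing_gt1.
have [|v vW vG] := exists_row_avoiding W fam disj; first by rewrite rW.
exists (W + v)%MS.
  have W0 : (W :&: v)%MS = 0.
    apply/eqP/rowV0P=> u; rewrite sub_capmx => /andP[uW /sub_rVP[c uc]].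
    move: uW; rewrite uc; have [->|c0] := eqVneq c 0; first by rewrite scale0r.
    by rewrite (eqmx_scale _ c0) (negPf vW).
  rewrite mxrank_disjoint_sum // rW rank_rV.
  by case: eqP vW => [->|_]; rewrite ?sub0mx ?addn1.
apply/allP=> G Gfam; apply/mxdisjointP=> u /sub_addsmxP[[x y] /= uE] uG.
move: uE; rewrite [y]mx11_scalar mul_scalar_mx.
have [->|c0] := eqVneq (y 0 0) 0.
  rewrite scale0r addr0 => uE; move/allP/(_ G Gfam)/mxdisjointP: disj.
  by apply=> //; rewrite uE submxMl.
(* A nonzero coefficient would make a multiple of [v] equal to [u - x *m W], with [u] in [G], so [v]
   would lie in [W + G]. *)
move=> uE; case/negP: (allP vG G Gfam).
rewrite -(eqmx_scale _ c0); apply/sub_addsmxP; exists (- x, u *m pinvmx G).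
by rewrite /= mulmxKpV // mulNmx uE addKr.
Qed.

(** * Partial spreads *)

(* The witnesses are the multiplications by the elements of the field with
   [p ^ A] elements. *)
Lemma exists_mx_spread_set (p A : nat) :
    prime p -> (0 < A)%N ->
  exists2 s : seq 'M['F_p]_A, size s = (p ^ A)%N
    & pairwise (fun X Y => X - Y \in unitmx) s.
Proof.
move=> pr_p A_gt0; have [K chK cardK] := pPrimePowerField pr_p A_gt0.
pose L : fieldExtType 'F_p := pPrimeCharType chK.
have dimL : dim L = A.
  by rewrite -dimvf pprimeChar_dimf cardK pfactorK.
rewrite -{A_gt0}dimL in cardK *.
pose mulL (x : L) : 'M['F_p]_(dim L) := lin1_mx (v2r \o (x \*o r2v)).
have mulLE x u : u *m mulL x = v2r (x * r2v u) by rewrite mul_rV_lin1.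
exists [seq mulL x | x <- enum K]; first by rewrite size_map -cardE.
rewrite pairwise_map; apply/(pairwiseP (0 : K)) => i j.
rewrite !inE => lti ltj ltij.
have: nth 0 (enum K) i != nth 0 (enum K) j.
  by rewrite nth_uniq ?enum_uniq ?neq_ltn ?ltij.
move: (nth _ _ i) (nth _ _ j) => x y xy /=.
rewrite -row_free_unit; apply: inj_row_free => u; rewrite mulmxBr !mulLE.
rewrite -raddfB -mulrBl => xyu0.
have /eqP : (x - y : L) * r2v u = 0 by apply: v2r_inj; rewrite xyu0 raddf0.
rewrite mulf_eq0 subr_eq0 (negPf xy) /= => /eqP u0.
by rewrite -[u]r2vK u0 raddf0.
Qed.

(** [U] is the second factor, and the others are the graphs of the maps [P *m X]. Two graphs meet
    where u P (X - Y) = 0, which forces u = 0 since [P] is injective and [X - Y] is invertible. *)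
Lemma exists_partial_spread (p A b : nat) :
    prime p -> (0 < A)%N -> (b <= A)%N ->
  exists U : 'M['F_p]_(b + A), exists s : seq 'M['F_p]_(b + A),
    [/\ \rank U = A, size s = (p ^ A)%N, all (fun T => \rank T == b) s
      & pairwise mxdisjoint (rcons s U)].
Proof.
move=> pr_p A_gt0 le_bA.
have [s size_s pw_s] := exists_mx_spread_set p A pr_p A_gt0.
pose P : 'M['F_p]_(b, A) := pid_mx b.
have freeP : row_free P by rewrite /row_free rank_pid_mx.
pose T (X : 'M['F_p]_A) : 'M['F_p]_(b + A) := <<row_mx 1%:M (P *m X)>>%MS.
have subT v X : (v <= T X)%MS -> exists u : 'rV_b, v = row_mx u (u *m P *m X).
  rewrite genmxE => /submxP[u ->]; exists u.
  by rewrite mul_mx_row mulmx1 mulmxA.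
exists <<row_mx (0 : 'M_(A, b)) 1%:M>>%MS, [seq T X | X <- s]; split.
- rewrite genmxE; apply/eqP/row_freeP; exists (col_mx 0 1%:M).
  by rewrite mul_row_col mul0mx mulmx1 add0r.
- by rewrite size_map.
- apply/allP=> _ /mapP[X _ ->]; rewrite genmxE; apply/row_freeP.
  by exists (col_mx 1%:M 0); rewrite mul_row_col mulmx0 mulmx1 addr0.
rewrite pairwise_rcons pairwise_map; apply/andP; split.
  apply/allP=> _ /mapP[X _ ->]; apply/mxdisjointP=> v /subT[u ->].
  rewrite genmxE => /submxP[w]; rewrite mul_mx_row mulmx0 => /eq_row_mx[-> _].
  by rewrite !mul0mx row_mx0.
apply: sub_pairwise pw_s => X Y /= uXY.
apply/mxdisjointP=> v /subT[u ->] /subT[w].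
case/eq_row_mx=> -> /eqP; rewrite -subr_eq0 -mulmxBr.
rewrite mulmx_free_eq0 ?row_free_unit // mulmx_free_eq0 // => /eqP->.
by rewrite !mul0mx row_mx0.
Qed.

(** * Families with prescribed dimensions *)

Lemma exists_disjoint_family_of_spread (p e A m : nat) (al : seq nat) :
    prime p -> (0 < A)%N -> (A <= e)%N -> (e <= 2 * A)%N ->
    (size al <= p ^ A)%N -> all (fun a => (a <= e - A)%N) al -> (m <= A)%N ->
  exists2 fam : seq 'M['F_p]_e, pairwise mxdisjoint fam
    & [seq \rank G | G <- fam] = rcons al m.
Proof.
move=> pr_p A_gt0 le_Ae le_eA szal le_al le_m.
have le_bA : (e - A <= A)%N by lia.
have := exists_partial_spread p A (e - A) pr_p A_gt0 le_bA.
rewrite subnK // => -[U [s [rU szs /allP rs pw]]].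
have szt : size (take (size al) s) = size al by rewrite size_takel ?szs.
apply: (@exists_disjoint_submx _ _ (rcons (take (size al) s) U)).
- apply: subseq_pairwise pw; rewrite -!cats1; apply: cat_subseq => //.
  exact: take_subseq.
- by rewrite !size_rcons szt.
move=> i; rewrite size_rcons ltnS !nth_rcons szt.
case: ltngtP => // [lti _|_ _]; last by rewrite rU.
rewrite nth_take // (eqP (rs _ _)) ?mem_nth // ?szs ?(leq_trans lti) //.
by apply: (allP le_al); rewrite mem_nth.
Qed.

(** Induction from the smallest dimension [a]: if [a] is small, it is added greedily to a family for
    the tail; otherwise every dimension is large and a spread handles the whole list at once. *)
Lemma exists_disjoint_family (p e : nat) (al : seq nat) :
    prime p -> sorted leq al -> all (fun a => (0 < a <= e)%N) al ->
    pairwise (fun a b => (a + b <= e)%N) al ->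
    (\sum_(a <- al) (p ^ a - 1) <= p ^ e - 1)%N ->
    ((\sum_(a <- al) (p ^ a - 1) - 1) ^ 4 < p ^ (3 * e))%N ->
  exists2 fam : seq 'M['F_p]_e, pairwise mxdisjoint fam
    & [seq \rank G | G <- fam] = al.
Proof.
move=> pr_p; have p_gt1 := prime_gt1 pr_p.
elim: al => [|a al IH]; first by exists [::].
set d := (\sum_(_ <- _ :: _) _)%N.
have dE : d = (p ^ a - 1 + \sum_(a <- al) (p ^ a - 1))%N by rewrite /d big_cons.
move=> sorted_al pos_al pw_al le_d lt_d.
have /andP[/andP[a_gt0 le_ae] pos_al'] := pos_al.
have [small|large] := leqP (4 * a.-1) e.
  have [|||||fam disj_fam rank_fam] := IH.
  - exact: path_sorted sorted_al.
  - exact: pos_al'.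
  - by case/andP: pw_al.
  - by apply: leq_trans le_d; rewrite dE leq_addl.
  - by apply: leq_ltn_trans lt_d; rewrite leq_exp2r // leq_sub2r // dE leq_addl.
  have [|W rW disjW] := exists_disjoint_mx fam a; last first.
    by exists (W :: fam) => /=; rewrite ?disjW ?rW ?rank_fam.
  rewrite card_Fp //.
  have -> : (\sum_(G <- fam) (p ^ \rank G - 1) = d - (p ^ a - 1))%N.
    by rewrite dE addKn -rank_fam big_map.
  have pa_gt1 : (1 < p ^ a)%N by rewrite -{1}(expn0 p) ltn_exp2l.
  rewrite ltnNge; apply/negP.
  rewrite -{1}(subnKC (_ : a.-1 <= e)%N) ?(leq_trans (leq_pred _)) //.
  rewrite expnD leq_pmul2l ?expn_gt0 ?(ltnW p_gt1) // => ge_d.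
  (* If p^a >= 3, then [ge_d] gives p^(e-a+1) <= d - 1, and 4 (e-a+1) >= 3e contradicts [lt_d]. If
     p^a = 2, the bound d <= p^e - 1 takes over. *)
  have [pa_gt2|pa_le2] := ltnP 2 (p ^ a).
    move: lt_d; rewrite ltnNge => /negP; apply.
    apply: (@leq_trans ((p ^ (e - a.-1)) ^ 4)).
      by rewrite -expnM leq_exp2l //; lia.
    by rewrite leq_exp2r //; lia.
  have a1 : a = 1%N.
    apply/eqP; rewrite eqn_leq a_gt0 andbT leqNgt; apply/negP=> a_gt1.
    have : (p ^ 2 <= p ^ a)%N by rewrite leq_exp2l.
    by nia.
  by move: ge_d; rewrite a1 subn0; lia.
have large_al c : c \in a :: al -> (a <= c)%N.
  rewrite inE => /orP[/eqP-> //|].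
  exact: (allP (order_path_min leq_trans sorted_al)).
(* More than p^A terms, each at least p^a - 1 >= p^(a-1), would give d - 1 >= p^(A+a-1), while 4A >=
   2e and 4 (a-1) > e. *)
have size_al A : (e <= 2 * A)%N -> (size (a :: al) <= p ^ A)%N.
  move=> le_eA; rewrite leqNgt; apply/negP=> gt_size.
  have le_sum : (size (a :: al) * (p ^ a - 1) <= d)%N.
    have -> : (size (a :: al) * (p ^ a - 1)
        = \sum_(c <- a :: al) (p ^ a - 1))%N.
      by rewrite big_const_seq count_predT iter_addn_0 mulnC.
    rewrite /d !big_seq; apply: leq_sum => c c_al.
    by rewrite leq_sub2r // leq_exp2l // large_al.
  have pos_q : (0 < p ^ a.-1)%N by rewrite expn_gt0 (ltnW p_gt1).
  have paE : (p ^ a = p * p ^ a.-1)%N by rewrite -expnS prednK.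
  have le_d1 : (p ^ (A + a.-1) <= d - 1)%N by rewrite expnD; nia.
  move: lt_d; rewrite ltnNge => /negP; apply.
  apply: (@leq_trans ((p ^ (A + a.-1)) ^ 4)); last by rewrite leq_exp2r.
  by rewrite -expnM leq_exp2l //; lia.
move: sorted_al; rewrite (sorted_pairwise leq_trans).
(* Only a case split: the largest dimension [m] is taken off the end, to be placed in the member of
   dimension [A]. *)
elim/last_ind: {d dE le_d lt_d large_al IH}(a :: al) size_al pos_al pw_al.
  by exists [::].
move=> al' m _ size_al.
rewrite all_rcons !pairwise_rcons size_rcons in size_al *.
move=> /andP[/andP[m_gt0 le_me] _] /andP[sum_m _] /andP[/allP le_m _].
have [big|half] := ltnP e (2 * m).
  apply: (@exists_disjoint_family_of_spread p e m) => //; first exact: ltnW.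
    by apply: leq_trans (size_al m (ltnW big)); apply: leqnSn.
  by apply: sub_all sum_m => c; lia.
apply: (@exists_disjoint_family_of_spread p e (e - e %/ 2)) => //; try lia.
  by apply: leq_trans (size_al _ _); [apply: leqnSn|lia].
by apply/allP=> c /le_m /=; lia.
Qed.

(** * From subspaces to orthogonal arrays *)

Lemma card_mulmx_fiber {F : finFieldType} {m n : nat} (M : 'M[F]_(m, n))
    (y : 'rV[F]_n) :
  row_full M ->
  #|[set v : 'rV_m | v *m M == y]| = #|[set v : 'rV_m | v *m M == 0]|.
Proof.
case/row_fullP=> B BM.
rewrite -[RHS](card_imset _ (addrI (y *m B))); apply: eq_card => v.
rewrite inE; apply/eqP/imsetP => [vM|[w]].
  exists (v - y *m B); last by rewrite addrC subrK.
  by rewrite inE mulmxBl vM -mulmxA BM mulmx1 subrr.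
by rewrite inE => /eqP w0 ->; rewrite mulmxDl w0 addr0 -mulmxA BM mulmx1.
Qed.

(** Runs are the vectors of length [e]; the column of [G] pairs a run with a basis of [G]. For two
    disjoint subspaces the joint map is onto, so its fibres, which count the runs with a given pair
    of symbols, are equinumerous. *)
Lemma realized_of_disjoint_mx (p e : nat) (ps : symbol)
    (fam : seq 'M['F_p]_e) :
    prime p -> pairwise mxdisjoint fam ->
    col_levels ps = [seq (p ^ \rank G)%N | G <- fam] ->
  realized (p ^ e)%N ps.
Proof.
move=> pr_p disj; rewrite /realized => ->; set lv := [seq _ | _ <- _].
have cardF : #|'F_p| = p by rewrite card_Fp.
have cardV : (p ^ e)%N = #|{: 'rV['F_p]_e}| by rewrite card_mx mul1n cardF.
pose row_of (i : 'I_(p ^ e)) : 'rV['F_p]_e := enum_val (cast_ord cardV i).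
have row_of_bij : bijective row_of.
  exists (fun v => cast_ord (esym cardV) (enum_rank v)) => x.
    by rewrite /row_of enum_valK cast_ordK.
  by rewrite /row_of cast_ordKV enum_rankK.
pose M (G : 'M['F_p]_e) := (row_base G)^T.
pose f G (v : 'rV['F_p]_e) : nat := enum_rank (v *m M G).
have f_lt G v : (f G v < p ^ \rank G)%N.
  apply: leq_trans (ltn_ord _) _.
  by rewrite [X in (X <= _)%N]card_mx mul1n cardF.
have f_eq G c : (c < p ^ \rank G)%N ->
    exists y, forall v, (f G v == c) = (v *m M G == y).
  move=> lt_c; have lt_c' : (c < #|{: 'rV['F_p]_(\rank G)}|)%N.
    by rewrite card_mx mul1n cardF.
  exists (enum_val (Ordinal lt_c')) => v.
  by rewrite -(inj_eq enum_rank_inj) enum_valK.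
have lvE j : (j < size fam)%N -> nth 0%N lv j = (p ^ \rank (nth 0%R fam j))%N.
  by move=> ltj; rewrite (nth_map 0).
have lt_fam (j : 'I_(size lv)) : (j < size fam)%N.
  by have := ltn_ord j; rewrite [X in (_ < X)%N -> _]size_map.
exists (\matrix_(i, j) f (nth 0 fam j) (row_of i)); split.
  by move=> i j; rewrite mxE lvE.
move=> j1 j2 ne_j a b a' b'; rewrite !lvE //.
set G1 := nth 0 fam j1; set G2 := nth 0 fam j2.
have G12 : mxdisjoint G1 G2.
  have [lt_j|lt_j|/val_inj/eqP eq_j] := ltngtP j1 j2.
  - by move/(pairwiseP 0): disj; apply; rewrite ?inE.
  - by rewrite mxdisjoint_sym; move/(pairwiseP 0): disj; apply; rewrite ?inE.
  - by rewrite eq_j in ne_j.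
have full : row_full (row_mx (M G1) (M G2)).
  rewrite /row_full -tr_col_mx mxrank_tr -addsmxE.
  rewrite (adds_eqmx (eq_row_base G1) (eq_row_base G2)) mxrank_disjoint_sum //.
  exact/eqP.
suff count x y : (x < p ^ \rank G1)%N -> (y < p ^ \rank G2)%N ->
    pair_count (\matrix_(i, j) f (nth 0 fam j) (row_of i)) j1 j2 x y
    = #|[set v : 'rV_e | v *m row_mx (M G1) (M G2) == 0]|.
  by move=> *; rewrite !count.
move=> /f_eq[y1 y1E] /f_eq[y2 y2E].
rewrite -(card_mulmx_fiber _ (row_mx y1 y2) full) /pair_count.
rewrite -(card_imset _ (bij_inj row_of_bij)); apply: eq_card => v.
rewrite inE mul_mx_row; apply/imsetP/eqP => [[i]|/eq_row_mx[v1 v2]].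
  by rewrite !inE !mxE y1E y2E => /andP[/eqP<- /eqP<-] ->.
have [g _ gK] := row_of_bij; exists (g v); last by rewrite gK.
by rewrite !inE !mxE y1E y2E gK v1 v2 !eqxx.
Qed.

(** * Parameter sets with a prime power number of runs *)

Lemma mem_col_levels (ps : symbol) (s : nat) :
  s \in col_levels ps -> exists2 x, x \in ps & x.1 = s.
Proof.
case/flattenP=> _ /mapP[x xps ->]; rewrite mem_nseq => /andP[_ /eqP->].
by exists x.
Qed.

Lemma deg_freedom_col_levels (ps : symbol) :
  deg_freedom ps = (\sum_(s <- col_levels ps) (s - 1))%N.
Proof.
rewrite /deg_freedom big_flatten big_map; apply: eq_bigr => x _.
by rewrite big_nseq iter_addn_0 mulnC.
Qed.

Lemma pairwise_nseq {T : Type} (r : rel T) (n : nat) (x : T) :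
  ((1 < n)%N -> r x x) -> pairwise r (nseq n x).
Proof.
elim: n => // n IH rxx /=; rewrite all_nseq IH ?andbT; last first.
  by move=> lt1n; apply: rxx; apply: ltnW.
by case: n rxx {IH} => //= n ->.
Qed.

(** Two columns from the same entry of [ps] fall under (C2), two from different entries under (C3).
    For levels p^a and p^b the divisibility becomes a + b <= e. *)
Lemma pairwise_col_levels (N : nat) (ps : symbol) :
  parameter_set N ps ->
  pairwise (fun s t => (s <= t)%N && (s * t %| N)%N) (col_levels ps).
Proof.
case=> -[sorted_ps _] _ sq_ps mul_ps _.
move: sorted_ps; rewrite (sorted_pairwise ltn_trans).
elim: ps sq_ps mul_ps => // x ps IH sq_ps mul_ps /= /andP[/allP lt_x pw].
rewrite /col_levels /= pairwise_cat; apply/and3P; split.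
- apply/allrelP=> s t; rewrite mem_nseq => /andP[_ /eqP->].
  case/mem_col_levels=> y yps <-.
  have lt_xy : (x.1 < y.1)%N by apply: lt_x; apply: map_f.
  rewrite ltnW //= mul_ps ?mem_head ?inE ?yps ?orbT //.
  by apply: contraTneq lt_xy => ->; rewrite ltnn.
- by apply: pairwise_nseq => x2; rewrite leqnn mulnn sq_ps ?mem_head.
- apply: IH pw => [y yps|y z yps zps].
    by apply: sq_ps; rewrite inE yps orbT.
  by apply: mul_ps; rewrite inE ?yps ?zps orbT.
Qed.

Lemma realized_prime_power (p e : nat) (ps : symbol) :
    prime p -> parameter_set (p ^ e)%N ps ->
    ((deg_freedom ps - 1) ^ 4 < (p ^ e) ^ 3)%N ->
  realized (p ^ e)%N ps.
Proof.
move=> pr_p hps lt_d; have p_gt1 := prime_gt1 pr_p.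
have pw := pairwise_col_levels _ _ hps; case: hps => -[_ wf] dvd_ps _ _ le_d.
have levelE s : s \in col_levels ps ->
    (1 < s)%N /\ exists2 a, (a <= e)%N & s = (p ^ a)%N.
  case/mem_col_levels=> x xps <-; split; first by case: (wf x xps).
  exact/(dvdn_pfactor _ _ pr_p)/dvd_ps.
pose al := [seq logn p s | s <- col_levels ps].
have lvE : col_levels ps = [seq (p ^ a)%N | a <- al].
  rewrite -map_comp map_id_in // => s /levelE[_ [a _ ->]] /=.
  by rewrite pfactorK.
move: pw; rewrite lvE pairwise_map => pw.
have [|||||fam disj rank_fam] := @exists_disjoint_family p e al pr_p.
- rewrite (sorted_pairwise leq_trans).
  by apply: sub_pairwise pw => a b /andP[+ _]; rewrite leq_exp2l.
- apply/allP=> _ /mapP[s /levelE[s_gt1 [a le_ae sE]] ->]; move: s_gt1.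
  by rewrite sE pfactorK // le_ae andbT; case: a {le_ae sE}.
- by apply: sub_pairwise pw => a b /andP[_]; rewrite -expnD dvdn_Pexp2l.
- by move: le_d; rewrite deg_freedom_col_levels lvE big_map.
- by move: lt_d; rewrite deg_freedom_col_levels lvE big_map -expnM mulnC.
apply: (@realized_of_disjoint_mx p e ps fam) => //.
by rewrite lvE -rank_fam -map_comp.
Qed.

(** * The bound on the threshold *)

Lemma powR_3_4_le (R : realType) (N b : nat) :
  (N ^ 3 <= b ^ 4)%N -> (N%:R : R) `^ (3%:R / 4%:R) <= b%:R.
Proof.
move=> le_Nb; rewrite -(@ler_pXn2r _ 4) ?nnegrE ?powR_ge0 ?ler0n //.
rewrite -powR_mulrn ?powR_ge0 // -powRrM divfK ?pnatr_eq0 //.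
by rewrite powR_mulrn ?ler0n // -!natrX ler_nat.
Qed.

(** This is the case where everything is realized, with M = N - 1. It fails at M = 2, since 27 >
    16. *)
Lemma cube_succ_le_exp4 (M : nat) : (2 < M)%N -> (M.+1 ^ 3 <= M ^ 4)%N.
Proof.
move=> M_ge3.
have sq_ge : (3 * M <= M ^ 2)%N by rewrite -mulnn leq_mul2r M_ge3 orbT.
have cube_ge : (3 * M ^ 2 <= M ^ 3)%N.
  by rewrite (expnS M 2) leq_mul2r M_ge3 orbT.
have : (3 * M ^ 3 <= M ^ 4)%N by rewrite (expnS M 3) leq_mul2r M_ge3 orbT.
have -> : (M.+1 ^ 3 = M ^ 3 + 3 * M ^ 2 + 3 * M + 1)%N by lia.
by lia.
Qed.

Theorem theorem4 (R : realType) (N : nat)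
    (hN : exists p e : nat, [/\ prime p, (0 < e)%N & N = (p ^ e)%N])
    (hN3 : (3 < N)%N) :
  (N%:R : R) `^ (3%:R / 4%:R) <= (threshold N)%:R.
Proof.
apply: powR_3_4_le; have [all_N|not_all] := pselect (all_realized N).
  rewrite /threshold asboolT // subn1.
  by case: N hN3 {hN all_N} => // M; apply: cube_succ_le_exp4.
have [_ [ps [hps deg_ps not_ps]]] := thresholdP not_all.
(* The unrealized [ps] has one degree of freedom more than the threshold, which accounts for the
   [- 1] in [realized_prime_power]. *)
rewrite leqNgt; apply/negP=> lt_N; apply: not_ps.
have [p [e [pr_p _ NE]]] := hN; rewrite NE in hps *.
by apply: realized_prime_power hps _ => //; rewrite -NE deg_ps subn1.
Qed.
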